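(* Let $\Lambda$ and $\Gamma$ be discrete countable groups. Then $\Lambda$ strictly measurably imbeds into $\Gamma$ if and only if $\Lambda$ is a random subgroup of $\Gamma$.
   Context: All groups are discrete and countable, all measure spaces are standard, and all equalities and inclusions of measurable sets are understood up to null sets. For a measure preserving action of a countable group $\Delta$ on $(\Sigma,\mu)$, a fundamental domain is a measurable set $Z\subset\Sigma$ with $\Sigma=\bigsqcup_{\delta\in\Delta}\delta Z$ (up to null sets). A group $\Lambda$ strictly measurably imbeds (SMI) into a group $\Gamma$ if there exists a nonzero ($\sigma$-finite) measure space $(\Sigma,\mu)$ with a measurable, measure preserving action of $\Lambda\times\Gamma$ such that the actions of $\Lambda$ and of $\Gamma$ on $\Sigma$ admit Borel fundamental domains $Y$ and $X$ respectively, with $\mu(X)<\infty$ and $X\subset Y$. Let $[\Lambda,\Gamma]:=\{f:\Lambda\to\Gamma \mid f(e)=e\}$, a Polish space (with the topology of pointwise convergence, $\Gamma$ discrete), with the $\Lambda$-action $(\lambda\cdot f)(x):=f(x\lambda)f(\lambda)^{-1}$ for $f\in[\Lambda,\Gamma]$, $\lambda,x\in\Lambda$. A randomorphism from $\Lambda$ to $\Gamma$ is a $\Lambda$-invariant (Borel) probability measure on $[\Lambda,\Gamma]$. A randomorphism is a randembedding if it is supported on the injective maps (i.e. the set of injective maps has full measure). $\Lambda$ is a random subgroup of $\Gamma$ if there exists a randembedding from $\Lambda$ to $\Gamma$. *)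

(* Defs.v *)
From HB Require Import structures.
From mathcomp Require Import all_boot all_order all_algebra.
From mathcomp Require Import all_classical all_reals all_analysis.

Set Implicit Arguments.
Unset Strict Implicit.
Unset Printing Implicit Defensive.

Local Open Scope classical_set_scope.
Local Open Scope ring_scope.

Definition countable_group (G : groupType) : Prop := countable [set: G].

Definition polish_metric (R : realType) (P : metricType R) : Prop :=
  (forall F : set_system P, ProperFilter F -> cauchy F -> exists p : P, F --> p) /\
  (exists2 D : set P, countable D & dense D).

(* The sigma-algebra of [S] is, up to a bijection, the Borel sigma-algebra of
   a Polish space. *)
Definition standard_borel (R : realType) (d : measure_display)
    (S : measurableType d) : Prop :=
  exists (P : metricType R) (f : S -> P),
    [/\ polish_metric P, bijective f &
        forall A : set S, measurable A <-> <<s @open P >> (f @` A)].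

(* The action axioms hold at every point; only the conditions on sets
   (fundamental domains, inclusions) are up to null sets. As [G] is
   countable and discrete, joint measurability is measurability of each [a g]. *)
Section Actions.
Variables (R : realType) (d : measure_display) (S : measurableType d).
Variables (mu : {measure set S -> \bar R}) (G : groupType).
Implicit Types (a : G -> S -> S) (Z : set S).

Record measure_preserving_action a : Prop := MeasurePreservingAction {
  mpa_one : forall s, a 1%g s = s ;
  mpa_mul : forall g h s, a (g * h)%g s = a g (a h s) ;
  mpa_measurable : forall g, measurable_fun [set: S] (a g) ;
  mpa_preserving : forall g A, measurable A -> mu (a g @^-1` A) = mu A
}.

Definition fundamental_domain a Z : Prop :=
  [/\ measurable Z,
      mu.-negligible (~` \bigcup_(g in [set: G]) (a g @` Z)) &
      forall g h, g <> h -> mu.-negligible ((a g @` Z) `&` (a h @` Z))].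

End Actions.

Definition strictly_measurably_imbeds (R : realType) (L G : groupType) : Prop :=
  exists (d : measure_display) (S : measurableType d)
         (mu : {sigma_finite_measure set S -> \bar R})
         (a : (L * G)%type -> S -> S) (X Y : set S),
    [/\ standard_borel R S /\ mu [set: S] <> 0%E,
        measure_preserving_action mu a,
        fundamental_domain mu (fun l : L => a (l, 1%g)) Y
          /\ fundamental_domain mu (fun g : G => a (1%g, g)) X,
        (mu X < +oo)%E &
        mu.-negligible (X `\` Y)].

(* The space [L, G]: the subtype topology of the topology of pointwise
   convergence, [G] being discrete. *)
Definition based_maps (L G : groupType) : Type :=
  set_type [set f : {ptws L -> discrete_topology G} | f 1%g = (1%g : G)].

HB.instance Definition _ (L G : groupType) :=
  Topological.copy (based_maps L G)
    (set_type [set f : {ptws L -> discrete_topology G} | f 1%g = (1%g : G)]).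

Section BasedMaps.
Variables L G : groupType.

Definition based_map_fun (f : based_maps L G) : L -> G := set_val f.

Definition mk_based_map (f : L -> G) (f1 : f 1%g = 1%g) : based_maps L G :=
  exist _ (f : {ptws L -> discrete_topology G}) (mem_set f1).

Lemma based_map1 (f : based_maps L G) : based_map_fun f 1%g = 1%g.
Proof. exact: set_valP f. Qed.

HB.instance Definition _ := isPointed.Build (based_maps L G)
  (@mk_based_map (fun=> 1%g) erefl).

Fact based_map_act_subproof (l : L) (f : based_maps L G) :
  (based_map_fun f (1 * l) * (based_map_fun f l)^-1 = 1)%g.
Proof. by rewrite mul1g mulgV. Qed.

Definition based_map_act (l : L) (f : based_maps L G) : based_maps L G :=
  @mk_based_map
    (fun x => based_map_fun f (x * l) * (based_map_fun f l)^-1)%g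
    (based_map_act_subproof l f).

Definition borel_based_maps := g_sigma_algebraType (@open (based_maps L G)).

End BasedMaps.

Section Randomorphisms.
Variables (R : realType) (L G : groupType).
Implicit Types nu : probability (borel_based_maps L G) R.

Definition randomorphism nu : Prop :=
  forall (l : L) (A : set (borel_based_maps L G)), measurable A ->
    nu (based_map_act l @^-1` A) = nu A.

Definition randembedding nu : Prop :=
  randomorphism nu /\ {ae nu, forall f, injective (based_map_fun f)}.

Definition random_subgroup : Prop := exists nu, randembedding nu.

End Randomorphisms.

(* Main.v *)
(* From an imbedding, let [q s] be the unique [g] with [g s] in [X], and send
   [s] to [F s : l |-> q (l s) q(s)^-1].  The map [F] is [G]-invariant and
   [L]-equivariant, so it carries the normalised measure of [X] to a
   randomorphism; [F s] is injective because distinct [L]-translates of [X] are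
   disjoint, [X] being contained in [Y].
   Conversely, a randembedding [nu] yields [[L, G] * G] with [nu] times the
   counting measure, [l (f, p) = (l f, f(l) p)] and [g (f, p) = (f, p g^-1)].
   Here [X] is [p = 1], and since [l |-> f(l) p] is injective, each [L]-orbit
   has a unique point whose second coordinate comes first in an enumeration of [G]
   starting at [1]; these points form [Y]. *)
Require Import Defs.
From HB Require Import structures.
From mathcomp Require Import all_boot all_order all_algebra.
From mathcomp Require Import all_classical all_reals all_analysis.

Set Implicit Arguments.
Unset Strict Implicit.
Unset Printing Implicit Defensive.
Import Order.TTheory GRing.Theory Num.Theory.

Local Open Scope classical_set_scope.
Local Open Scope ring_scope.

(** * Countable unions and sums over countable index types *)

Section CountableFamilies.
Context d (T : measurableType d) (R : realType).
Implicit Types mu : {measure set T -> \bar R}.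

Lemma countable_bigcapT_measurable (I : Type) (F : I -> set T) :
  countable [set: I] -> (forall i, measurable (F i)) ->
  measurable (\bigcap_i F i).
Proof.
move=> cI mF; rewrite -[X in measurable X]setCK; apply: measurableC.
rewrite setC_bigcap.
by apply: countable_bigcupT_measurable => // i; exact: measurableC.
Qed.

(** A partial decoder turns a family over [I] into a sequence, with the empty set at naturals that
    code nothing. *)
Lemma nat_decoding (I : Type) : countable [set: I] ->
  exists2 c : I -> nat, injective c &
  exists dec : nat -> option I,
    pcancel c dec /\ (forall n i, dec n = Some i -> c i = n).
Proof.
move=> /countable_injP[c /in2TT injc]; exists c => //.
exists (fun n => if pselect (exists i, c i = n) is left p
                 then Some (projT1 (cid p)) else None).
split=> [i|n i]; last first.
  by case: pselect => // p [<-]; case: (cid p).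
case: pselect => [p|]; last by case; exists i.
by case: (cid p) => j /= /injc ->.
Qed.

Lemma negligible_countable_bigcup mu (I : Type) (F : I -> set T) :
  countable [set: I] -> (forall i, mu.-negligible (F i)) ->
  mu.-negligible (\bigcup_i F i).
Proof.
move=> /nat_decoding[c _ [dec [cK _]]] nF.
apply: (@negligibleS _ _ _ _
    (\bigcup_n (if dec n is Some i then F i else set0))).
  by move=> t [i _ Fit]; exists (c i) => //; rewrite cK.
apply: negligible_bigcup => n; case: (dec n) => [i|]; first exact: nF.
exact: negligible_set0.
Qed.

(** Along the code this is additivity over a sequence; naturals outside [range c] contribute
    [mu set0], hence [0]. *)
Lemma measure_countable_bigcup mu (I : choiceType) (F : I -> set T) :
  countable [set: I] -> (forall i, measurable (F i)) -> trivIset setT F ->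
  mu (\bigcup_i F i) = \esum_(i in [set: I]) mu (F i).
Proof.
move=> /nat_decoding[c injc [dec [cK decK]]] mF tF.
pose F' n := if dec n is Some i then F i else set0.
have -> : \bigcup_i F i = \bigcup_n F' n.
  apply/seteqP; split => t [i _ Fit]; first by exists (c i); rewrite // /F' cK.
  by move: Fit; rewrite /F'; case: (dec i) => // j Fj; exists j.
rewrite measure_semi_bigcup; first last.
- by rewrite /F'; apply: bigcup_measurable => n _; case: (dec n).
- move=> m n _ _ [t []]; rewrite /F'.
  case Em : (dec m) => [i|//] Fi; case En : (dec n) => [j|//] Fj.
  rewrite -(decK _ _ Em) -(decK _ _ En); congr c; apply: tF => //.
  by exists t.
- by move=> n; rewrite /F'; case: (dec n).
rewrite nneseries_esumT; last by [].
rewrite (esumID (range c)); last by [].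
rewrite [X in (_ + X)%E]esum1 ?adde0; last first.
  move=> n [_ nc]; rewrite /F'; case En : (dec n) => [i|]; last exact: measure0.
  by case: nc; exists i => //; exact: decK.
rewrite setTI esum_image; last by move=> i j _ _; exact: injc.
by apply: eq_esum => i _; rewrite /F' cK.
Qed.

End CountableFamilies.

Lemma exchange_esum (R : realType) (I J : choiceType) (a : I -> J -> \bar R) :
  (forall i j, (0 <= a i j)%E) ->
  \esum_(i in [set: I]) \esum_(j in [set: J]) a i j =
  \esum_(j in [set: J]) \esum_(i in [set: I]) a i j.
Proof.
move=> a0; rewrite !esum_esum//.
rewrite (@reindex_esum _ _ _ [set: J * I] _ (fun x => (x.2, x.1))).
  by congr esum; apply/seteqP; split.
split => //=; first by move=> [i j] [i' j'] _ _ [-> ->].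
by move=> [i j] _; exists (j, i).
Qed.

Lemma esum_reindex_bij (R : realType) (I : choiceType) (h h' : I -> I)
    (a : I -> \bar R) :
  cancel h h' -> cancel h' h ->
  \esum_(i in [set: I]) a (h i) = \esum_(i in [set: I]) a i.
Proof.
move=> hK h'K; rewrite -(@reindex_esum _ _ _ setT setT h)//.
split => //; first by move=> x y _ _; exact: (can_inj hK).
by move=> y _; exists (h' y).
Qed.

(** * Measurability through countably many discrete coordinates *)

Section CylinderSets.
Variables (I G : choiceType).
Hypotheses (cI : countable [set: I]) (cG : countable [set: G]).

Lemma countable_seq (T : Type) : countable [set: T] -> countable [set: seq T].
Proof.
move=> /countable_injP[c /in2TT injc]; apply/countable_injP.
exists (fun s => pickle (map c s)) => s t _ _ /(pcan_inj pickleK).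
exact: inj_map.
Qed.

(* Open sets determined locally by finitely many coordinates are countable
   unions of cylinders, since there are only countably many cylinders. *)
Lemma measurable_fun_coordinates d (T : measurableType d) (U : ptopologicalType)
    (ev : U -> I -> G) (F : T -> g_sigma_algebraType (@open U)) :
  (forall A : set U, open A -> forall u, A u ->
     exists s : seq I, forall v, {in s, ev v =1 ev u} -> A v) ->
  (forall i g, measurable [set t | ev (F t) i = g]) ->
  measurable_fun [set: T] F.
Proof.
move=> loc mF; apply: (@measurability _ _ T _ setT F (@open U)) => // _ [A oA <-].
rewrite setTI.
pose cyl (c : seq (I * G)) := [set u | forall p, p \in c -> ev u p.1 = p.2].
have mcyl c : measurable (F @^-1` cyl c).
  elim: c => [|p c IH].
    rewrite (_ : _ @^-1` _ = setT); first exact: measurableT.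
    by apply/seteqP; split => // t _ /= p; rewrite in_nil.
  rewrite (_ : _ @^-1` _ = [set t | ev (F t) p.1 = p.2] `&` F @^-1` cyl c).
    by apply: measurableI => //; exact: mF.
  apply/seteqP; split => t /=.
    move=> h; split; first by apply: h; rewrite mem_head.
    by move=> q qc; apply: h; rewrite in_cons qc orbT.
  by move=> [h1 h2] q; rewrite in_cons => /predU1P[->//|]; exact: h2.
rewrite (_ : F @^-1` A =
  \bigcup_c (if `[< cyl c `<=` A >] then F @^-1` cyl c else set0)).
  apply: countable_bigcupT_measurable; last by move=> c; case: ifP.
  by apply: countable_seq; rewrite -setXTT; exact: countableX.
apply/seteqP; split => t /=.
  move=> /(loc _ oA)[s hs]; exists [seq (i, ev (F t) i) | i <- s] => //.
  rewrite ifT; first by move=> _ /mapP[i _ ->].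
  apply/asboolP => v hv; apply: hs => i si.
  by apply: (hv (i, ev (F t) i)); apply/mapP; exists i.
by move=> [c _]; case: ifPn => // /asboolP cA; exact: cA.
Qed.

(** Failure of injectivity is a countable union, over pairs of distinct indices and over their
    common value. *)
Lemma measurable_injective d (T : measurableType d) (ev : T -> I -> G) :
  (forall i g, measurable [set t | ev t i = g]) ->
  measurable [set t | injective (ev t)].
Proof.
move=> mev; rewrite (_ : [set _ | _] = \bigcap_p (if p.1 == p.2 then setT else
    ~` \bigcup_g ([set t | ev t p.1 = g] `&` [set t | ev t p.2 = g]))).
  apply: countable_bigcapT_measurable.
    by rewrite -setXTT; exact: countableX.
  move=> p; case: ifP => // _; apply: measurableC.
  apply: countable_bigcupT_measurable => // g.
  by apply: measurableI; exact: mev.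
apply/seteqP; split=> t /=.
  move=> inj_t [i j] _ /=; case: eqP => // ij [g _ [/= ti tj]].
  by apply/ij/inj_t; rewrite ti.
move=> h i j tij; apply/eqP/negPn/negP => /negbTE nij.
have := h (i, j) Logic.I; rewrite /= nij; apply.
by exists (ev t j).
Qed.

End CylinderSets.

(** * The Borel structure of [[L, G]] *)

Section BasedMapsBorel.
Variables L G : groupType.

(** Agreement with [f] on finite lists generates a filter [B]. Convergence in the product topology
    is tested one coordinate at a time, and a one-element list settles each, so [B] refines the
    neighbourhoods of [f]. *)
Lemma nbhs_ptws_finite_coordinates (f : {ptws L -> discrete_topology G})
    (A : set {ptws L -> discrete_topology G}) : nbhs f A ->
  exists s : seq L, forall g, {in s, g =1 f} -> A g.
Proof.
pose B := filter_from [set: seq L]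
  (fun s => [set g : {ptws L -> discrete_topology G} | {in s, g =1 f}]).
have FB : Filter B.
  apply: filter_from_filter; first by exists [::].
  move=> s t _ _; exists (s ++ t) => // g gf.
  by split=> l ls; apply: gf; rewrite mem_cat ls ?orbT.
have /(_ A) : B --> f.
  apply/cvg_sup => l; apply/cvg_image.
    by apply/seteqP; split=> // x _; exists (fun=> x).
  move=> X /nbhs_singleton Xf; exists [set g | X (g l)].
    by exists [:: l] => // g /= gf; rewrite gf ?mem_head.
  by apply/seteqP; split=> [x [g Xg <-]//|x Xx]; exists (fun=> x).
by move=> /[apply] -[s _ sA]; exists s => g /sA.
Qed.

Lemma open_based_maps_finite_coordinates (A : set (based_maps L G)) :
  open A -> forall f, A f -> exists s : seq L,
    forall g, {in s, based_map_fun g =1 based_map_fun f} -> A g.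
Proof.
move=> [B oB <-] f Bf.
have [s sB] := @nbhs_ptws_finite_coordinates (set_val f) B
  (open_nbhs_nbhs (conj oB Bf)).
by exists s => g gf; exact: sB.
Qed.

Lemma measurable_based_map_coord (l : L) (g : G) :
  measurable [set f : borel_based_maps L G | based_map_fun f l = g].
Proof.
apply: sub_sigma_algebra.
exists [set f : {ptws L -> discrete_topology G} | f l = g] => //.
have /continuousP cp :
    continuous (fun f : {ptws L -> discrete_topology G} => f l).
  exact: (@proj_continuous L (fun=> discrete_topology G) l).
by apply: (cp [set g]); exact: discrete_open.
Qed.

End BasedMapsBorel.

(* The code [e] and its injectivity are parameters of the type, as the metric
   depends on them. *)
Definition prefix_space (R : realType) (I : choiceType) (G : groupType)
  (e : I -> nat) (inj_e : injective e) : Type := I -> G.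

(** * A Polish metric on the space of all maps [I -> G] *)

Section PrefixSpace.
Variables (R : realType) (I : choiceType) (G : groupType).
Variables (e : I -> nat) (inj_e : injective e).

Local Notation P := (@prefix_space R I G e inj_e).

HB.instance Definition _ := Choice.copy P (I -> G).
HB.instance Definition _ := isPointed.Build P (fun=> 1%g).

(** For [f <> g] the supremum is [1 / (n + 1)], where [n] is the least code of a coordinate at which
    they differ; the [0] keeps the set nonempty when [f = g]. *)
Definition prefix_dist (f g : P) : R :=
  sup [set r | r = 0 \/ exists2 i, f i <> g i & r = (e i).+1%:R^-1].

Let dist_has_sup (f g : P) :
  has_sup [set r : R | r = 0 \/ exists2 i, f i <> g i & r = (e i).+1%:R^-1].
Proof.
split; first by exists 0; left.
by exists 1 => r [->//|[i _ ->]]; rewrite invf_le1 ?ltr0n// ler1n.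
Qed.

Lemma prefix_dist_le (f g : P) (r : R) : 0 <= r ->
  prefix_dist f g <= r <-> (forall i, f i <> g i -> (e i).+1%:R^-1 <= r).
Proof.
move=> r0; split => [fgr i fgi|fgr].
  apply: le_trans fgr; apply: (@sup_upper_bound _ _ (dist_has_sup f g)).
  by right; exists i.
apply: ge_sup; first exact: (dist_has_sup f g).1.
by move=> _ [->//|[i fgi ->]]; exact: fgr.
Qed.

Let prefix_dist_ge0 (f g : P) : 0 <= prefix_dist f g.
Proof. by apply: (@sup_upper_bound _ _ (dist_has_sup f g)); left. Qed.

Let prefix_dist_ge (f g : P) i : f i <> g i -> (e i).+1%:R^-1 <= prefix_dist f g.
Proof. by apply: (iffLR (prefix_dist_le f g _)). Qed.

Let prefix_distxx (f : P) : prefix_dist f f = 0.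
Proof.
by apply/eqP; rewrite eq_le prefix_dist_ge0 andbT; apply/prefix_dist_le.
Qed.

Let prefix_dist_eq0 (f g : P) : prefix_dist f g = 0 -> f = g.
Proof.
move=> fg0; apply/funext => i; apply: contrapT => /prefix_dist_ge.
by rewrite fg0 leNgt invr_gt0 ltr0n.
Qed.

Let prefix_dist_sym (f g : P) : prefix_dist f g = prefix_dist g f.
Proof.
by apply/eqP; rewrite eq_le; apply/andP; split; apply/prefix_dist_le => // i /nesym;
  exact: prefix_dist_ge.
Qed.

Let prefix_dist_triangle (g f h : P) :
  prefix_dist f h <= prefix_dist f g + prefix_dist g h.
Proof.
apply/prefix_dist_le => [|i fh]; first exact: addr_ge0.
have [fg|/prefix_dist_ge fg] := pselect (f i = g i).
  by rewrite ler_wpDl// prefix_dist_ge// -fg.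
by rewrite ler_wpDr.
Qed.

HB.instance Definition _ := isMetric.Build R P
  prefix_distxx prefix_dist_eq0 prefix_dist_sym prefix_dist_triangle.

Let ball_prefix (f g : P) n :
  ball f (n.+1%:R^-1 : R) g <-> (forall i, (e i <= n)%N -> f i = g i).
Proof.
rewrite ballEmdist /=; split=> [fgn i ein|fg].
  apply: contrapT => /prefix_dist_ge; apply/negP; rewrite -ltNge.
  by apply: lt_le_trans fgn _; rewrite lef_pV2 ?posrE ?ltr0n// ler_nat ltnS.
(* Differing coordinates have code at least [n + 1], so the distance is at most [1 / (n + 2)], which
   gives the strict inequality of open balls. *)
apply: (@le_lt_trans _ _ (n.+2%:R^-1)); last first.
  by rewrite ltf_pV2 ?posrE ?ltr0n// ltr_nat.
apply/prefix_dist_le => // i fgi; rewrite lef_pV2 ?posrE ?ltr0n// ler_nat ltnS.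
by rewrite ltnNge; apply/negP => /fg.
Qed.

Let ball_small (f : P) (r : R) : 0 < r ->
  exists n, ball f (n.+1%:R^-1 : R) `<=` ball f r.
Proof.
move=> r0; exists (Num.truncn r^-1); apply: le_ball.
by rewrite -[leRHS]invrK lef_pV2 ?posrE ?invr_gt0// ltW// truncnS_gt.
Qed.

(** Along a Cauchy filter each coordinate is eventually constant; these eventual values form the
    limit. *)
Lemma prefix_space_complete (F : set_system P) :
  ProperFilter F -> cauchy F -> exists p : P, F --> p.
Proof.
move=> PF /cauchyP cF.
have cF' n : exists f : P, F (ball f (n.+1%:R^-1 : R)).
  by apply: cF; rewrite invr_gt0 ltr0n.
have /choice[p Fp] : forall i, exists v, F [set g : P | g i = v].
  move=> i; have [f Ff] := cF' (e i); exists (f i).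
  by apply: filterS Ff => g /ball_prefix/(_ i (leqnn _)).
exists (p : P); apply/fcvg_ballP => r /(@ball_small p)[n pn].
have [f Ff] := cF' n; apply: filterS (Ff) => g /ball_prefix fg; apply: pn.
apply/ball_prefix => i ein; rewrite -fg//.
have [h [/= <- /ball_prefix]] := filter_ex (filterI (Fp i) Ff).
by move=> ->.
Qed.

(** A ball of radius [1 / (n + 1)] constrains only the coordinates with code at most [n], and
    injectivity of [e] leaves finitely many of them. *)
Lemma open_prefix_finite_coordinates (A : set P) : open A -> forall f, A f ->
  exists s : seq I, forall g : P, {in s, g =1 f} -> A g.
Proof.
move=> oA f Af.
have /nbhs_ballP[r r0 rA] : nbhs f A by exact: open_nbhs_nbhs.
have [n nr] := @ball_small f r r0.
have /finite_seqP[s sE] : finite_set [set i | (e i <= n)%N].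
  apply: (@finite_preimage _ _ [set k | (k <= n)%N] e) => //.
    by move=> i j _ _; exact: inj_e.
  exact: (sub_finite_set _ (finite_II n.+1)).
exists s => g gf; apply/rA/nr/ball_prefix => i ein; rewrite gf//.
by have : [set` s] i by rewrite -sE.
Qed.

Lemma measurable_prefix_coord (i : I) (v : G) :
  measurable [set f : g_sigma_algebraType (@open P) | f i = v].
Proof.
apply: sub_sigma_algebra; rewrite /= openE => f /= fi.
apply/nbhs_ballP; exists ((e i).+1%:R^-1) => /=; first by rewrite invr_gt0 ltr0n.
by move=> g /ball_prefix fg; rewrite /= -fg.
Qed.

Hypothesis cG : countable [set: G].

Lemma prefix_space_separable : exists2 D : set P, countable D & dense D.
Proof.
(* The dense set consists of the maps equal to [1] outside a finite list, of which there are
   countably many. *)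
pose lookup (c : seq (I * G)) : P :=
  fun i => foldr (fun p v => if p.1 == i then p.2 else v) 1%g c.
exists (range lookup).
  apply: card_le_trans (card_image_le _ _) _; apply: countable_seq.
  rewrite -setXTT; apply: countableX => //.
  by apply/countable_injP; exists e => i j _ _; exact: inj_e.
move=> O [f Of] oO; have [s sO] := open_prefix_finite_coordinates oO Of.
pose c := [seq (i, f i) | i <- s]; exists (lookup c); split; last by exists c.
apply: sO => i; rewrite /lookup /c; elim: s {c} => //= j s IH.
by rewrite in_cons; have [->|_ /IH] := eqVneq i j.
Qed.

Lemma prefix_space_polish : polish_metric P.
Proof. by split; [exact: prefix_space_complete|exact: prefix_space_separable]. Qed.

End PrefixSpace.

(** * From a randembedding to an imbedding: the suspension *)

Section Suspension.
Variables (R : realType) (L G : groupType).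
Variables (e : L -> nat) (inj_e : injective e).
Hypotheses (cL : countable [set: L]) (cG : countable [set: G]).
Variable nu : probability (borel_based_maps L G) R.

Local Notation S := (g_sigma_algebraType (@open (@prefix_space R L G e inj_e))).

(* [f] and [p] stand for the point [(f, p)] of [[L, G] * G]; identifying it
   with [f p] turns this product into the space of all maps [L -> G]. *)
Definition suspend (p : G) (f : borel_based_maps L G) : S :=
  fun x => (based_map_fun f x * p)%g.

(** In these coordinates the twist by [f(l)] disappears: [(l f)(x) f(l) p = f(x l) p], so [L] only
    translates the argument. *)
Definition suspension_act (k : L * G) (phi : S) : S :=
  fun x => (phi (x * k.1) * k.2^-1)%g.

Lemma measurable_fun_prefix_space d (T : measurableType d) (F : T -> S) :
  (forall i g, measurable [set t | F t i = g]) -> measurable_fun [set: T] F.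
Proof.
move=> mF; apply: (@measurable_fun_coordinates _ _ cL cG _ _
  (@prefix_space R L G e inj_e) (fun u => u)) => //.
exact: open_prefix_finite_coordinates.
Qed.

Lemma measurable_suspend p : measurable_fun [set: borel_based_maps L G] (suspend p).
Proof.
apply: measurable_fun_prefix_space => i g.
rewrite (_ : [set _ | _] = [set f | based_map_fun f i = g * p^-1]%g).
  exact: measurable_based_map_coord.
by apply/seteqP; split=> f /= => [<-|E]; rewrite /suspend ?E ?mulgK ?mulgVK.
Qed.

Lemma measurable_suspension_act k : measurable_fun [set: S] (suspension_act k).
Proof.
apply: measurable_fun_prefix_space => i g.
rewrite (_ : [set _ | _] = [set phi : S | phi (i * k.1) = g * k.2]%g).
  exact: measurable_prefix_coord.
by apply/seteqP; split=> f /= => [<-|E]; rewrite /suspension_act ?E ?mulgK ?mulgVK.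
Qed.

Lemma measurable_based_map_act l :
  measurable_fun [set: borel_based_maps L G]
    (@based_map_act L G l : borel_based_maps L G -> borel_based_maps L G).
Proof.
apply: (@measurable_fun_coordinates _ _ cL cG _ _ _ (@based_map_fun L G)).
  exact: open_based_maps_finite_coordinates.
(* A coordinate of [l f] also involves [f(l)]; cutting along this value leaves conditions on single
   coordinates. *)
move=> x g; rewrite (_ : [set _ | _] = \bigcup_h
  ([set f | based_map_fun f l = h] `&` [set f | based_map_fun f (x * l) = g * h]%g)).
  apply: countable_bigcupT_measurable => // h.
  by apply: measurableI; exact: measurable_based_map_coord.
apply/seteqP; split=> f /=.
  by move=> <-; exists (based_map_fun f l) => //; split => //=; rewrite mulgVK.
move=> [h _ /= [<- fx]].
by rewrite -[LHS]/(based_map_fun f (x * l) * _)%g fx mulgK.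
Qed.

(** This is [nu] times the counting measure, read through [suspend]: the slice of [A] over [p] is
    its preimage under [suspend p]. *)
Definition suspension_measure (A : set S) : \bar R :=
  \esum_(p in [set: G]) nu (suspend p @^-1` A).

Local Notation mu := suspension_measure.

Let measurable_suspend_preimage p (A : set S) :
  measurable A -> measurable (suspend p @^-1` A).
Proof. by move=> mA; rewrite -[X in measurable X]setTI; exact: measurable_suspend. Qed.

Let suspension_measure0 : mu set0 = 0%E.
Proof. by apply: esum1 => p _; rewrite preimage_set0 measure0. Qed.

Let suspension_measure_ge0 A : (0 <= mu A)%E.
Proof. by apply: esum_ge0 => p _; exact: measure_ge0. Qed.

Let suspension_measure_sigma_additive : semi_sigma_additive mu.
Proof.
move=> F mF tF mUF.
rewrite [X in _ --> X](_ : _ = \sum_(0 <= n <oo) mu (F n))%E.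
  by apply: is_cvg_nneseries => n _ _; exact: suspension_measure_ge0.
rewrite nneseries_esumT//.
rewrite -exchange_esum => [|p n]; last exact: measure_ge0.
apply: eq_esum => p _; rewrite preimage_bigcup measure_semi_bigcup//.
- by rewrite nneseries_esumT.
- by move=> n; exact: measurable_suspend_preimage.
- apply/trivIsetP => i j _ _ ij; rewrite -preimage_setI.
  by move/trivIsetP : tF => /(_ _ _ _ _ ij) ->//; rewrite preimage_set0.
- by rewrite -preimage_bigcup; exact: measurable_suspend_preimage.
Qed.

HB.instance Definition _ := isMeasure.Build _ _ _ mu
  suspension_measure0 suspension_measure_ge0 suspension_measure_sigma_additive.

(** Since [f(1) = 1], the map [suspend p f] has value [p] at the unit, so only the term [p = q]
    survives, with the full mass of [nu]. At [q = 1] this is the measure of [X]. *)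
Lemma suspension_measure_fiber q : mu [set phi : S | phi 1%g = q] = 1%E.
Proof.
rewrite /suspension_measure (esumID [set q]); last by move=> *; exact: measure_ge0.
rewrite setTI esum_set1 ?measure_ge0// [X in (_ + X)%E]esum1 ?adde0.
  rewrite (_ : _ @^-1` _ = setT) ?probability_setT//.
  by apply/seteqP; split=> // f _; rewrite /= /suspend based_map1 mul1g.
move=> p [_ /= pq]; rewrite (_ : _ @^-1` _ = set0) ?measure0//.
by apply/seteqP; split=> // f; rewrite /= /suspend based_map1 mul1g.
Qed.

Let suspension_sigma_finite : sigma_finite [set: S] mu.
Proof.
have [c _ [dec [cK _]]] := nat_decoding cG.
exists (fun n => if dec n is Some q then [set phi : S | phi 1%g = q] else set0).
  apply/esym/seteqP; split => // phi _; exists (c (phi 1%g)) => //.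
  by rewrite cK.
move=> n; case: (dec n) => [q|]; last by rewrite measure0; split.
rewrite [mu _]suspension_measure_fiber ltry; split=> //.
exact: measurable_prefix_coord.
Qed.

HB.instance Definition _ := Measure_isSigmaFinite.Build _ _ _ mu
  suspension_sigma_finite.

(* For fixed [l], the fibre coordinate [p] of [(f, p)] becomes [f(l) p g^-1]:
   splitting along the value of [f(l)], this is a permutation of [G]. *)
Lemma suspension_preserving : randomorphism nu ->
  forall k (A : set S), measurable A -> mu (suspension_act k @^-1` A) = mu A.
Proof.
move=> nu_inv [l g] A mA; rewrite /suspension_measure.
pose act_l : borel_based_maps L G -> borel_based_maps L G := @based_map_act L G l.
pose B q r : set (borel_based_maps L G) :=
  [set f | based_map_fun f l = q] `&` act_l @^-1` (suspend r @^-1` A).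
have mact C : measurable C -> measurable (act_l @^-1` C).
  by move=> mC; rewrite -[X in measurable X]setTI; exact: measurable_based_map_act.
have mB q r : measurable (B q r).
  apply: measurableI; first exact: measurable_based_map_coord.
  by apply: mact; exact: measurable_suspend_preimage.
have tB (h : G -> G) : trivIset setT (fun q => B q (h q)).
  by move=> q r _ _ [f [[/= <- _] [/= <- _]]].
transitivity (\esum_(p in [set: G]) \esum_(q in [set: G])
    nu (B q (q * p * g^-1)%g)).
  apply: eq_esum => p _; rewrite -measure_countable_bigcup//.
  have act f : suspension_act (l, g) (suspend p f) =
      suspend (based_map_fun f l * p * g^-1)%g (based_map_act l f).
    apply/funext => x; rewrite /suspension_act /suspend /=.
    by rewrite -[RHS]/(based_map_fun f (x * l) * _ * _)%g !mulgA mulgVK.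
  congr (nu _); apply/seteqP; split=> f /=.
    by rewrite act => Af; exists (based_map_fun f l).
  by move=> [q _ [/= <-]]; rewrite -act.
rewrite exchange_esum; last by move=> *; exact: measure_ge0.
under eq_esum => q _.
  rewrite (@esum_reindex_bij _ _ (fun p => q * p * g^-1)%g
    (fun p => q^-1 * p * g)%g (fun r => nu (B q r))); first last.
  - by move=> p; rewrite !mulgA mulgV mul1g mulgK.
  - by move=> p; rewrite !mulgA mulVg mul1g mulgVK.
  over.
(* With [r] fixed, the pieces [B q r] over all [q] make up a preimage under [act_l], where the
   invariance of [nu] applies. *)
rewrite exchange_esum; last by move=> *; exact: measure_ge0.
apply: eq_esum => r _; rewrite -measure_countable_bigcup//.
rewrite -(nu_inv l (suspend r @^-1` A)); last exact: measurable_suspend_preimage.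
congr (nu _); apply/seteqP; split=> f /=; first by move=> [q _ []].
by move=> Af; exists (based_map_fun f l).
Qed.

Lemma suspension_action : randomorphism nu ->
  measure_preserving_action mu suspension_act.
Proof.
move=> nu_inv; split=> [phi|[l g] [l' g'] phi|k|k A mA].
- by apply/funext => x; rewrite /suspension_act /= !mulg1 invg1 mulg1.
- by apply/funext => x; rewrite /suspension_act /= invgM !mulgA.
- exact: measurable_suspension_act.
- exact: suspension_preserving.
Qed.

Definition suspension_sigma_finite_measure :
  {sigma_finite_measure set S -> \bar R} := mu.

Let X : set S := [set phi | phi 1%g = 1%g].

Let Inj : set S := [set phi | injective (phi : L -> G)].

Let measurable_Inj : measurable Inj.
Proof.
apply: (measurable_injective cL cG) => l g; exact: measurable_prefix_coord.
Qed.

Hypothesis nu_emb : randembedding nu.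

(** Right multiplication by [p] does not affect injectivity, so each slice is null by [nu_emb]. *)
Let negligible_not_Inj : mu.-negligible (~` Inj).
Proof.
exists (~` Inj); split => //; first exact: measurableC.
apply: esum1 => p _; apply: measure_negligible.
  by apply: measurable_suspend_preimage; exact: measurableC.
apply: negligibleS nu_emb.2 => f /= finj inj_f; apply: finj => l m.
by move/mulIg/inj_f.
Qed.

Let suspension_action_Gamma g (phi : S) :
  suspension_act (1%g, g) phi = fun x => (phi x * g^-1)%g.
Proof. by apply/funext => x; rewrite /suspension_act /= mulg1. Qed.

Let suspension_action_Lambda l (phi : S) :
  suspension_act (l, 1%g) phi = fun x => phi (x * l)%g.
Proof. by apply/funext => x; rewrite /suspension_act /= invg1 mulg1. Qed.

(** The element [g] multiplies the value at the unit by [g^-1] on the right, so every [phi] has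
    exactly one translate in [X]. *)
Let X_fundamental_domain :
  fundamental_domain mu (fun g : G => suspension_act (1%g, g)) X.
Proof.
split; first exact: measurable_prefix_coord.
  rewrite (_ : ~` _ = set0); first exact: negligible_set0.
  apply/seteqP; split => // phi; apply; exists (phi 1%g)^-1%g => //.
  exists (fun x => phi x * (phi 1%g)^-1)%g; first by rewrite /X /= mulgV.
  by rewrite suspension_action_Gamma; apply/funext => x; rewrite invgK mulgVK.
move=> g h gh; rewrite (_ : _ `&` _ = set0); first exact: negligible_set0.
apply/seteqP; split => // phi [[y Xy <-] [y' Xy']].
rewrite !suspension_action_Gamma => /(congr1 (fun u : S => u 1%g)).
by rewrite Xy Xy' !mul1g => /invg_inj/esym.
Qed.

(* Coding the unit by [0] puts almost all of [X] inside the transversal of the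
   [L]-orbits that picks a point of least coordinate in each orbit. *)
Lemma random_subgroup_imbeds : strictly_measurably_imbeds R L G.
Proof.
have /countable_injP[c /in2TT inj_c] := cG.
pose rank g := if g == 1%g then 0%N else (c g).+1.
have inj_rank : injective rank.
  move=> g h; rewrite /rank.
  by case: eqP => [->|_]; case: eqP => // _ [] /inj_c.
pose Y := Inj `&` \bigcap_l \bigcup_p ([set phi : S | phi 1%g = p.1] `&`
  [set phi : S | phi l = p.2 /\ (rank p.1 <= rank p.2)%N]).
have YP phi : Y phi <-> Inj phi /\ forall l, (rank (phi 1%g) <= rank (phi l))%N.
  split=> -[inj_phi phi1]; split=> // l.
    by have [[p q] _ [/= -> [-> ]]] := phi1 l Logic.I.
  by move=> _; exists (phi 1%g, phi l); do !split => //=; exact: phi1.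
have mY : measurable Y.
  apply: measurableI => //; apply: countable_bigcapT_measurable => // l.
  apply: countable_bigcupT_measurable => [|p].
    by rewrite -setXTT; exact: countableX.
  apply: measurableI; first exact: measurable_prefix_coord.
  have [pq|pq] := boolP (rank p.1 <= rank p.2)%N.
    rewrite (_ : [set _ | _] = [set phi : S | phi l = p.2]).
      exact: measurable_prefix_coord.
    by apply/seteqP; split=> phi //= [].
  by rewrite (_ : [set _ | _] = set0)//; apply/seteqP; split=> phi //= [].
exists _, S, suspension_sigma_finite_measure, (@suspension_act), X, Y; split.
- split.
    exists (@prefix_space R L G e inj_e), id; split.
    + exact: prefix_space_polish.
    + by exists id.
    + by move=> A; rewrite image_id.
  move=> muT; have : (mu X <= mu setT)%E.
    by apply: le_measure; rewrite ?inE//; exact: measurable_prefix_coord.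
  by rewrite muT [X in (X <= _)%E]suspension_measure_fiber lee_fin ler10.
- exact: suspension_action nu_emb.1.
- split; last exact: X_fundamental_domain.
  split=> //.
    apply: negligibleS negligible_not_Inj => phi nY inj_phi; apply: nY.
    (* The least rank among the values of [phi] is attained at some [l]; the translate of [phi] by
       [l] attains it at the unit. *)
    have /ex_minnP[n /asboolP[l lE] lmin] :
        exists n, `[< exists l, rank (phi l) = n >].
      by exists (rank (phi 1%g)); apply/asboolP; exists 1%g.
    exists l^-1%g => //; exists (fun x => phi (x * l)%g); last first.
      by rewrite suspension_action_Lambda; apply/funext => x; rewrite mulgVK.
    apply/YP; split=> [x y /inj_phi/mulIg//|x]; rewrite mul1g lE.
    by apply: lmin; apply/asboolP; eexists.
  move=> l m lm; rewrite (_ : _ `&` _ = set0); first exact: negligible_set0.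
  apply/seteqP; split => // phi [[y /YP[inj_y ymin] <-] [y' /YP[_ y'min]]].
  rewrite !suspension_action_Lambda => yy'; apply: lm.
  have y'E x : y' (x * m)%g = y (x * l)%g by have := congr1 (fun u : S => u x) yy'.
  (* Each of [y 1] and [y' 1] is a value of the other map, so minimality on both sides forces equal
     ranks, and injectivity of [y] gives [l = m]. *)
  have y1 : y 1%g = y' (l^-1 * m)%g by rewrite y'E mulVg.
  have y'1 : y' 1%g = y (m^-1 * l)%g by rewrite -y'E mulVg.
  have /inj_rank : rank (y 1%g) = rank (y' 1%g).
    by apply/eqP; rewrite eqn_leq {1}y'1 ymin y1 y'min.
  rewrite y'1 => /inj_y/esym/eqP; rewrite mulg_eq1 => /eqP/invg_inj.
  by [].
- by rewrite [X in (X < _)%E]suspension_measure_fiber ltry.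
- apply: negligibleS negligible_not_Inj => phi [Xphi nY] inj_phi; apply: nY.
  by apply/YP; split=> // l; rewrite Xphi /rank eqxx.
Qed.

End Suspension.

(** * Pulling sets back along a measure preserving action *)

Section ActionTools.
Context (R : realType) d (S : measurableType d).
Variables (mu : {measure set S -> \bar R}) (K : groupType) (a : K -> S -> S).
Hypothesis mpa : measure_preserving_action mu a.

Lemma action_invK k s : a k^-1%g (a k s) = s.
Proof. by rewrite -(mpa_mul mpa) mulVg (mpa_one mpa). Qed.

Lemma measurable_action_preimage k A : measurable A -> measurable (a k @^-1` A).
Proof.
by move=> mA; rewrite -[X in measurable X]setTI; exact: (mpa_measurable mpa).
Qed.

Lemma negligible_action_preimage k A :
  mu.-negligible A -> mu.-negligible (a k @^-1` A).
Proof.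
move=> [B [mB B0 AB]]; exists (a k @^-1` B); split.
- exact: measurable_action_preimage.
- by rewrite (mpa_preserving mpa).
- by move=> s; exact: AB.
Qed.

End ActionTools.

(** * From an imbedding to a randembedding *)

Section Imbedding.
Context (R : realType) (L G : groupType) d (S : measurableType d).
Hypotheses (cL : countable [set: L]) (cG : countable [set: G]).
Variables (mu : {measure set S -> \bar R}) (a : L * G -> S -> S).
Hypothesis mpa : measure_preserving_action mu a.

Let pair_invL (l : L) : (l^-1, 1 : G)%g = ((l, 1 : G)^-1)%g.
Proof. by rewrite -[in LHS](invg1 G). Qed.

Let pair_invG (g : G) : (1 : L, g^-1)%g = ((1 : L, g)^-1)%g.
Proof. by rewrite -[in LHS](invg1 L). Qed.

(* Discarding the null set of all orbits that meet the exceptional sets turns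
   the conditions on the fundamental domains into pointwise ones. *)
Lemma exact_fundamental_domain (X Y : set S) :
  fundamental_domain mu (fun l => a (l, 1%g)) Y ->
  fundamental_domain mu (fun g => a (1%g, g)) X ->
  mu [set: S] <> 0%E -> mu.-negligible (X `\` Y) ->
  exists X' : set S, [/\ measurable X' /\ X' `<=` X, mu X' <> 0%E,
    (forall s g h, X' (a (1%g, g) s) -> X' (a (1%g, h) s) -> g = h),
    (forall s l m, X' (a (l, 1%g) s) -> X' (a (m, 1%g) s) -> l = m) &
    (forall s k, X' s -> exists g, X' (a (1%g, g) (a k s)))].
Proof.
move=> [mY _ tY] [mX coverX tX] muS XY.
pose bad (H : groupType) (b : H -> S -> S) Z := \bigcup_p
  (if p.1 == p.2 then set0 else (b p.1 @` Z) `&` (b p.2 @` Z)).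
have badP (H : groupType) (b : H -> S -> S) Z : countable [set: H] ->
    (forall g h, g <> h -> mu.-negligible ((b g @` Z) `&` (b h @` Z))) ->
    mu.-negligible (bad H b Z).
  move=> cH tZ; apply: negligible_countable_bigcup.
    by rewrite -setXTT; exact: countableX.
  move=> p; case: eqP => [_|]; [exact: negligible_set0 | exact: tZ].
have [B [mB B0 NB]] := negligibleU (negligibleU coverX XY)
  (negligibleU (badP _ _ _ cL tY) (badP _ _ _ cG tX)).
(* Removing every translate of [B] makes [good] invariant under both groups. *)
pose good := ~` \bigcup_k a k @^-1` B.
have cK : countable [set: (L * G)%type] by rewrite -setXTT; exact: countableX.
have mgood : measurable good.
  apply: measurableC; apply: countable_bigcupT_measurable => // k.
  exact: (measurable_action_preimage mpa).
have ngood : mu.-negligible (~` good).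
  rewrite setCK; apply: negligible_countable_bigcup => // k.
  by apply: (negligible_action_preimage mpa); apply/negligibleP.
have good_act k s : good s -> good (a k s).
  move=> gs [h _ /= Bh]; apply: gs; exists (h * k)%g => //=.
  by rewrite (mpa_mul mpa).
have good_inv k s : good (a k s) -> good s.
  by move=> /(good_act k^-1%g); rewrite (action_invK mpa).
have goodB s : good s -> ~ B s.
  by move=> gs Bs; apply: gs; exists 1%g => //=; rewrite (mpa_one mpa).
have goodcover s : good s -> exists g, X (a (1%g, g) s).
  move=> gs; apply: contrapT => nX; apply: (goodB _ gs); apply: NB; left; left.
  move=> [g _ [x Xx xs]]; apply: nX; exists g^-1%g.
  suff -> : a (1%g, g^-1%g) s = x by [].
  by rewrite -xs pair_invG (action_invK mpa).
(* Through [i], one argument serves both [L] and [G]: two elements moving [s] into [Z] put [s] in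
   the translates of [Z] by their inverses. *)
have unique (H : groupType) (i : H -> L * G) (Z : set S) (s : S) (g h : H) :
    (forall g, i g^-1%g = (i g)^-1%g) ->
    bad H (fun g => a (i g)) Z `<=` B -> good s ->
    Z (a (i g) s) -> Z (a (i h) s) -> g = h.
  move=> iV badB gs Zg Zh; apply: contrapT => gh.
  apply: (goodB _ gs); apply: badB; exists (g^-1, h^-1)%g => //=.
  case: eqP => [/invg_inj//|_]; split.
    by exists (a (i g) s) => //; rewrite iV (action_invK mpa).
  by exists (a (i h) s) => //; rewrite iV (action_invK mpa).
exists (X `&` good); split.
- by split=> [|s []//]; exact: measurableI.
(* If the trimmed [X] were null, so would be its countably many translates, which cover [good], and
   then all of [S]. *)
- move=> X0; apply: muS; apply/(negligibleP _ measurableT).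
  apply: (@negligibleS _ _ _ _
      (~` good `|` \bigcup_g a (1%g, g) @^-1` (X `&` good))).
    move=> s _; have [gs|] := pselect (good s); last by left.
    have [g Xg] := goodcover s gs; right; exists g => //; split => //.
    exact: good_act.
  apply: negligibleU => //; apply: negligible_countable_bigcup => // g.
  apply: (negligible_action_preimage mpa).
  by apply/negligibleP => //; exact: measurableI.
- move=> s g h [Xg gg] [Xh _]; apply: (unique _ (fun g => (1%g, g)) X s) => //.
  + by move=> t bt; apply: NB; right; right.
  + exact: good_inv gg.
- have XYgood t : X t -> good t -> Y t.
    move=> Xt gt; apply: contrapT => nYt; apply: (goodB _ gt); apply: NB.
    by left; right.
  move=> s l m [Xl gl] [Xm gm]; apply: (unique _ (fun l => (l, 1%g)) Y s) => //.
  + by move=> t bt; apply: NB; right; left.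
  + exact: good_inv gl.
  + exact: XYgood.
  + exact: XYgood.
- move=> s k [Xs gs]; have [g Xg] := goodcover _ (good_act k s gs).
  by exists g; split => //; exact/good_act/good_act.
Qed.

Variable X : set S.
Hypothesis mX : measurable X.
Hypothesis X_inj_G : forall s g h,
  X (a (1%g, g) s) -> X (a (1%g, h) s) -> g = h.
Hypothesis X_inj_L : forall s l m,
  X (a (l, 1%g) s) -> X (a (m, 1%g) s) -> l = m.
Hypothesis X_cover : forall s k, X s -> exists g, X (a (1%g, g) (a k s)).

(** The default [1] is the value at points whose [G]-orbit misses [X]; points of [X] and all their
    translates have a genuine return element. *)
Definition return_elt (s : S) : G := xget 1%g [set g | X (a (1%g, g) s)].

Local Notation q := return_elt.

Lemma return_elt_eq s g : X (a (1%g, g) s) -> q s = g.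
Proof. by move=> Xg; apply: xget_unique => // h Xh; exact: X_inj_G Xh Xg. Qed.

Let return_elt_subproof s :
  (q (a (1%g : L, 1%g : G) s) * (q s)^-1 = 1)%g.
Proof. by rewrite (mpa_one mpa) mulgV. Qed.

Definition return_cocycle (s : S) : borel_based_maps L G :=
  @mk_based_map L G (fun l => q (a (l, 1%g) s) * (q s)^-1)%g
    (return_elt_subproof s).

Local Notation F := return_cocycle.

Let return_cocycleE s l :
  based_map_fun (F s) l = (q (a (l, 1%g) s) * (q s)^-1)%g.
Proof. by []. Qed.

Lemma measurable_return_elt g : measurable [set s | q s = g].
Proof.
(* Because of the default, the fibre over [1] also contains the points whose [G]-orbit misses
   [X]. *)
rewrite (_ : [set s | q s = g] = (a (1%g, g) @^-1` X) `|`
    (if g == 1%g then ~` \bigcup_h a (1%g, h) @^-1` X else set0)).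
  apply: measurableU; first exact: (measurable_action_preimage mpa).
  case: ifP => // _; apply: measurableC.
  apply: countable_bigcupT_measurable => // h.
  exact: (measurable_action_preimage mpa).
apply/seteqP; split=> s /=; last first.
  case=> [/return_elt_eq//|]; case: eqP => // -> nX.
  by apply: xgetPN => h Xh; apply: nX; exists h.
have [[h Xh]|nX] := pselect (exists h, X (a (1%g, h) s)).
  by rewrite (return_elt_eq Xh) => <-; left.
rewrite /return_elt xgetPN; last by move=> h Xh; apply: nX; exists h.
by move=> <-; right; rewrite eqxx => -[h _ Xh]; apply: nX; exists h.
Qed.

Lemma measurable_return_cocycle : measurable_fun [set: S] F.
Proof.
apply: (@measurable_fun_coordinates _ _ cL cG _ _ _ (@based_map_fun L G)).
  exact: open_based_maps_finite_coordinates.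
move=> l g; rewrite (_ : [set _ | _] = \bigcup_h
  ([set s | q s = h] `&` a (l, 1%g) @^-1` [set s | q s = g * h]%g)).
  apply: countable_bigcupT_measurable => // h.
  apply: measurableI; first exact: measurable_return_elt.
  by apply: (measurable_action_preimage mpa) => //; exact: measurable_return_elt.
apply/seteqP; split=> s /=.
  by rewrite return_cocycleE => <-; exists (q s) => //; split=> //=; rewrite mulgVK.
by move=> [h _ [/= <- E]]; rewrite return_cocycleE E mulgK.
Qed.

Let pair_mul (l m : L) (g h : G) : ((l, g) * (m, h) = (l * m, g * h))%g.
Proof. by []. Qed.

Lemma return_cocycle_equivariant s l g :
  X s -> F (a (l, g) s) = based_map_act l (F s).
Proof.
move=> Xs.
(* By uniqueness, [h] changes [q] by the right factor [h^-1], which cancels in the quotient defining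
   [F]. *)
have q_act m h : q (a (m, h) s) = (q (a (m, 1%g) s) * h^-1)%g.
  have [k Xk] := X_cover (m, 1%g) Xs; rewrite (return_elt_eq Xk).
  apply: return_elt_eq; rewrite -(mpa_mul mpa) pair_mul mulgVK mul1g.
  by move: Xk; rewrite -(mpa_mul mpa) pair_mul mul1g mulg1.
apply: val_inj; apply/funext => x /=.
rewrite !return_cocycleE -(mpa_mul mpa) pair_mul mul1g.
by rewrite (q_act (x * l)%g g) (q_act l g) !mulgKA.
Qed.

(** If [l] and [m] have the same image, a single [g] returns both [l s] and [m s] to [X]; then [l]
    and [m] both carry [g s] into [X], so they agree. *)
Lemma return_cocycle_injective s : X s -> injective (based_map_fun (F s)).
Proof.
move=> Xs l m; rewrite !return_cocycleE => /mulIg lm.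
have [g Xg] := X_cover (l, 1%g) Xs; have [h Xh] := X_cover (m, 1%g) Xs.
move: lm; rewrite (return_elt_eq Xg) (return_elt_eq Xh) => gh; subst h.
apply: (@X_inj_L (a (1%g, g) s)).
  by move: Xg; rewrite -!(mpa_mul mpa) !pair_mul !mulg1 !mul1g.
by move: Xh; rewrite -!(mpa_mul mpa) !pair_mul !mulg1 !mul1g.
Qed.

(* Both sides are cut along the pieces on which [a (l, g)] maps [X] to [X]. *)
Lemma return_cocycle_invariant l (A : set (borel_based_maps L G)) :
  measurable A ->
  mu (X `&` F @^-1` (based_map_act l @^-1` A)) = mu (X `&` F @^-1` A).
Proof.
move=> mA.
have mXA : measurable (X `&` F @^-1` A).
  apply: measurableI => //; rewrite -[X in measurable X]setTI.
  exact: measurable_return_cocycle.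
have mP k : measurable (X `&` a k @^-1` (X `&` F @^-1` A)).
  by apply: measurableI => //; exact: (measurable_action_preimage mpa).
have mQ k : measurable (a k @^-1` X `&` (X `&` F @^-1` A)).
  by apply: measurableI => //; exact: (measurable_action_preimage mpa).
have uniq_act m s g h : X (a (m, g) s) -> X (a (m, h) s) -> g = h.
  move=> Xg Xh; apply: (@X_inj_G (a (m, 1%g) s)).
    by rewrite -(mpa_mul mpa) pair_mul mul1g mulg1.
  by rewrite -(mpa_mul mpa) pair_mul mul1g mulg1.
have cover_act m s : X s -> exists g, X (a (m, g) s).
  move=> /(X_cover (m, 1%g))[g]; rewrite -(mpa_mul mpa) pair_mul mul1g mulg1.
  by exists g.
transitivity (mu (\bigcup_g (X `&` a (l, g) @^-1` (X `&` F @^-1` A)))).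
  congr (mu _); apply/seteqP; split=> s /=.
    move=> [Xs As]; have [g Xg] := cover_act l s Xs; exists g => //.
    by do 2 split => //=; rewrite return_cocycle_equivariant.
  by move=> [g _ [Xs [/= Xg]]]; rewrite return_cocycle_equivariant.
rewrite measure_countable_bigcup//; last first.
  by move=> g h _ _ [s [[_ [Xg _]] [_ [Xh _]]]]; exact: (uniq_act l s).
transitivity (mu (\bigcup_g
    (a (l, g)^-1%g @^-1` X `&` (X `&` F @^-1` A)))); last first.
  congr (mu _); apply/seteqP; split=> s /=; first by move=> [g _ []].
  move=> [Xs As]; have [g Xg] := cover_act l^-1%g s Xs; exists g^-1%g => //.
  split=> //; rewrite /= -[((l, g^-1)^-1)%g]/(l^-1, g^-1^-1)%g invgK.
  exact: Xg.
rewrite measure_countable_bigcup//; last first.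
  move=> g h _ _ [s [[Xg _] [Xh _]]]; apply: invg_inj.
  exact: (uniq_act l^-1%g s).
(* The [g]-th piece of the first union is the preimage under [a (l, g)] of the [g]-th piece of the
   second. *)
apply: eq_esum => g _; rewrite -[RHS](mpa_preserving mpa (l, g))//.
congr (mu _); apply/seteqP; split=> s /=; rewrite (action_invK mpa)//.
Qed.

Hypotheses (muX0 : mu X <> 0%E) (muXoo : (mu X < +oo)%E).

Lemma imbedding_random_subgroup : random_subgroup R L G.
Proof.
have [m mE] : exists m : {measure set (borel_based_maps L G) -> \bar R},
    forall A, m A = mu (X `&` F @^-1` A).
  unshelve eexists (pushforward (mrestr mu mX) F).
    exact: measurable_return_cocycle.
  by move=> A; rewrite /= /pushforward /mrestr setIC.
have mT : m setT = mu X by rewrite mE preimage_setT setIT.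
pose c := (fine (mu X))^-1%:E.
(* [mnormalize] falls back on the Dirac mass only when the total mass is zero or infinite, and
   [mu X] is neither. *)
have nuE A : mnormalize m \d_(point : borel_based_maps L G) A = (m A * c)%E.
  by rewrite /mnormalize mT; case: ifPn => // /orP[/eqP//|/eqP moo];
    move: muXoo; rewrite moo.
exists (mnormalize m \d_(point : borel_based_maps L G)); split.
  move=> l A mA; rewrite [LHS]nuE [RHS]nuE !mE.
  by rewrite return_cocycle_invariant.
pose injective_maps := [set f : borel_based_maps L G | injective (based_map_fun f)].
have minj : measurable injective_maps.
  apply: (measurable_injective cL cG) => l g; exact: measurable_based_map_coord.
exists (~` injective_maps); split=> //; first exact: measurableC.
rewrite [LHS]nuE mE (_ : _ `&` _ = set0) ?measure0 ?mul0e//.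
by apply/seteqP; split => // s [Xs]; apply; exact: return_cocycle_injective.
Qed.

End Imbedding.


Theorem proposition2p7 (R : realType) (Lambda Gamma : groupType)
    (countableLambda : countable_group Lambda)
    (countableGamma : countable_group Gamma) :
  strictly_measurably_imbeds R Lambda Gamma <-> random_subgroup R Lambda Gamma.
Proof.
split.
  move=> [d [S [mu [a [X [Y [[_ muS] mpa [domY domX] muX XY]]]]]]].
  have [X' [[mX' X'X] X'0 injG injL cover]] :=
    exact_fundamental_domain countableLambda countableGamma mpa domY domX muS XY.
  apply: (imbedding_random_subgroup countableLambda countableGamma mpa mX') => //.
  apply: le_lt_trans muX; apply: le_measure; rewrite ?inE//.
  by have [] := domX.
move=> [nu nu_emb].
have /countable_injP[e /in2TT inj_e] := countableLambda.
exact: (random_subgroup_imbeds inj_e countableLambda countableGamma nu_emb).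
Qed.
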